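(* Let $(E,C)$ be a separated graph. Then there is a natural group isomorphism $\mathrm{Aut}(\mathcal S(E,C))\cong\mathrm{Aut}(E,C)$.
   Context: A directed graph $E=(E^0,E^1,s,r)$ consists of sets $E^0$ (vertices), $E^1$ (edges), of arbitrary cardinality, and maps $s,r\colon E^1\to E^0$. A separated graph $(E,C)$ is a directed graph with $C=\bigsqcup_{v\in E^0}C_v$, where $C_v$ is a partition of $s^{-1}(v)$ into pairwise disjoint nonempty subsets ($C_v=\emptyset$ if $s^{-1}(v)=\emptyset$). $E^{-1}=\{e^{-1}:e\in E^1\}$ is a set of formal inverses, $\hat E^1=E^1\sqcup E^{-1}$, $s(e^{-1})=r(e)$, $r(e^{-1})=s(e)$. $\mathcal S(E,C)$ is the universal inverse semigroup with zero generated by $E^0\cup\hat E^1$ subject to: (1) $vw=\delta_{v,w}v$ for $v,w\in E^0$; (2) $s(x)x=x$ and (3) $xr(x)=x$ for $x\in\hat E^1$; (4) $e^{-1}f=\delta_{e,f}r(e)$ for $e,f\in X$, $X\in C$. $\mathrm{Aut}(E,C)$ is the group of graph automorphisms $\phi=(\phi^0,\phi^1)$ of $E$ such that $\phi^1(X)\in C$ for all $X\in C$. $\mathrm{Aut}(\mathcal S(E,C))$ is the group of all semigroup automorphisms of $\mathcal S(E,C)$. The natural map in question is $\mathrm{Aut}(E,C)\to\mathrm{Aut}(\mathcal S(E,C))$ sending $\phi$ to the semigroup homomorphism determined by $v\mapsto\phi^0(v)$, $e\mapsto\phi^1(e)$, $e^{-1}\mapsto\phi^1(e)^{-1}$, $0\mapsto0$.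 *)

(* Defs.v *)
From HB Require Import structures.
From mathcomp Require Import all_boot generic_quotient.
From mathcomp Require Import boolp classical_sets.

Set Implicit Arguments.
Unset Strict Implicit.
Unset Printing Implicit Defensive.

Local Open Scope classical_set_scope.
Local Open Scope group_scope.
Local Open Scope quotient_scope.

(* [inv x] is the unique generalized inverse of [x]; having such an operation
   is being an inverse semigroup. *)
Definition is_inverse_op (S : semigroupType) (inv : S -> S) : Prop :=
  forall x y : S, (x * y * x = x /\ y * x * y = y) <-> y = inv x.

Definition is_zero (S : semigroupType) (z : S) : Prop :=
  forall x : S, z * x = z /\ x * z = z.

Inductive iterm (X : Type) : Type :=
| TZero
| TGen of X
| TMul of iterm X & iterm X
| TInv of iterm X.

Arguments TZero {X}.

HB.instance Definition _ (X : Type) := gen_eqMixin (iterm X).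
HB.instance Definition _ (X : Type) := gen_choiceMixin (iterm X).

(* The least congruence containing [R] and the equational axioms of inverse
   semigroups with zero. *)
Inductive icong (X : Type) (R : iterm X -> iterm X -> Prop) :
    iterm X -> iterm X -> Prop :=
| icong_rel s t : R s t -> icong R s t
| icong_refl s : icong R s s
| icong_sym s t : icong R s t -> icong R t s
| icong_trans s t u : icong R s t -> icong R t u -> icong R s u
| icong_mul s s' t t' :
    icong R s s' -> icong R t t' -> icong R (TMul s t) (TMul s' t')
| icong_inv s s' : icong R s s' -> icong R (TInv s) (TInv s')
| icong_mulA s t u : icong R (TMul s (TMul t u)) (TMul (TMul s t) u)
| icong_mul0 s : icong R (TMul TZero s) TZero
| icong_0mul s : icong R (TMul s TZero) TZero
| icong_invK s : icong R (TInv (TInv s)) s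
| icong_invM s t : icong R (TInv (TMul s t)) (TMul (TInv t) (TInv s))
| icong_regular s : icong R (TMul (TMul s (TInv s)) s) s
| icong_idem_comm s t :
    icong R (TMul (TMul s (TInv s)) (TMul t (TInv t)))
            (TMul (TMul t (TInv t)) (TMul s (TInv s))).

Section Presented.
Variables (X : Type) (R : iterm X -> iterm X -> Prop).

Definition icongb (s t : iterm X) : bool := `[< icong R s t >].

Lemma icongb_refl : reflexive icongb.
Proof. by move=> s; apply/asboolP; exact: icong_refl. Qed.

Lemma icongb_sym : symmetric icongb.
Proof.
by move=> s t; apply/idP/idP => /asboolP h; apply/asboolP; exact: icong_sym.
Qed.

Lemma icongb_trans : transitive icongb.
Proof.
by move=> t s u /asboolP st /asboolP tu; apply/asboolP; exact: icong_trans tu.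
Qed.

Canonical icong_equiv := EquivRel icongb icongb_refl icongb_sym icongb_trans.

(* The universal inverse semigroup with zero generated by [X] subject to [R];
   its universal property is [presented_universal]. *)
Definition presented : Type := {eq_quot icong_equiv}.

HB.instance Definition _ := Choice.on presented.
HB.instance Definition _ := Quotient.on presented.

Definition pcls (t : iterm X) : presented := \pi_presented t.
Definition pzero : presented := pcls TZero.
Definition pgen (x : X) : presented := pcls (TGen x).
Definition pmul (a b : presented) : presented := pcls (TMul (repr a) (repr b)).
Definition pinv (a : presented) : presented := pcls (TInv (repr a)).

Lemma pclsP s t : pcls s = pcls t <-> icong R s t.
Proof. by split=> [/eqmodP/asboolP | h] //; apply/eqmodP/asboolP. Qed.

Lemma pcls_ind (P : presented -> Prop) : (forall t, P (pcls t)) -> forall a, P a.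
Proof. by move=> h a; rewrite -[a]reprK; exact: h. Qed.

Lemma repr_pcls t : icong R (repr (pcls t)) t.
Proof. by apply/pclsP; rewrite /pcls reprK. Qed.

Lemma pmulE s t : pmul (pcls s) (pcls t) = pcls (TMul s t).
Proof. by apply/pclsP/icong_mul; exact: repr_pcls. Qed.

Lemma pinvE s : pinv (pcls s) = pcls (TInv s).
Proof. by apply/pclsP/icong_inv; exact: repr_pcls. Qed.

Lemma pmulA : associative pmul.
Proof.
elim/pcls_ind=> s; elim/pcls_ind=> t; elim/pcls_ind=> u.
by rewrite !pmulE; apply/pclsP; exact: icong_mulA.
Qed.

HB.instance Definition _ := isSemigroup.Build presented pmulA.

Lemma pclsM s t : pcls s * pcls t = pcls (TMul s t).
Proof. exact: pmulE. Qed.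

Lemma pzeroP : is_zero pzero.
Proof.
elim/pcls_ind=> s; rewrite /pzero !pclsM; split; apply/pclsP.
  exact: icong_mul0.
exact: icong_0mul.
Qed.

Lemma pinvK (a : presented) : pinv (pinv a) = a.
Proof.
by elim/pcls_ind: a => s; rewrite !pinvE; apply/pclsP; exact: icong_invK.
Qed.

Lemma pmulVm (a : presented) : a * pinv a * a = a.
Proof.
elim/pcls_ind: a => s; rewrite pinvE !pclsM.
by apply/pclsP; exact: icong_regular.
Qed.

Lemma pidemC (a b : presented) :
  (a * pinv a) * (b * pinv b) = (b * pinv b) * (a * pinv a).
Proof.
elim/pcls_ind: a => s; elim/pcls_ind: b => t; rewrite !pinvE !pclsM.
by apply/pclsP; exact: icong_idem_comm.
Qed.

Lemma pinvM (a b : presented) : pinv (a * b) = pinv b * pinv a.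
Proof.
elim/pcls_ind: a => s; elim/pcls_ind: b => t.
by rewrite !(pinvE, pclsM); apply/pclsP; exact: icong_invM.
Qed.

Lemma pVmulm (a : presented) : pinv a * a * pinv a = pinv a.
Proof. by have := pmulVm (pinv a); rewrite pinvK. Qed.

Lemma pidemV (e : presented) : e * e = e -> e = e * pinv e.
Proof.
move=> ee; have ff : pinv e * pinv e = pinv e by rewrite -pinvM ee.
have C := pidemC e (pinv e).
have h1 : e * pinv e * (pinv e * pinv (pinv e)) = e.
  by rewrite pinvK mulgA -[e * pinv e * _]mulgA ff pmulVm.
have h2 : pinv e * pinv (pinv e) * (e * pinv e) = pinv e.
  by rewrite pinvK mulgA -[pinv e * e * e]mulgA ee pVmulm.
by have fe : e = pinv e; [rewrite -{1}h1 C h2 | rewrite -fe ee].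
Qed.

Lemma pidem_comm (e f : presented) : e * e = e -> f * f = f -> e * f = f * e.
Proof. by move=> /pidemV -> /pidemV ->; exact: pidemC. Qed.

Lemma pinvP : is_inverse_op pinv.
Proof.
move=> x y; split=> [[xyx yxy]|->]; last by rewrite pmulVm pVmulm.
set z := pinv x; have xzx : x * z * x = x := pmulVm x.
have zxz : z * x * z = z := pVmulm x.
have C1 : (y * x) * (z * x) = (z * x) * (y * x).
  by apply: pidem_comm; rewrite !mulgA ?yxy ?zxz.
have C2 : (x * y) * (x * z) = (x * z) * (x * y).
  by apply: pidem_comm; rewrite !mulgA ?xyx ?xzx.
have yE : y = z * x * y.
  rewrite -{1}yxy -{1}xzx.
  have -> : y * (x * z * x) * y = (y * x) * (z * x) * y by rewrite !mulgA.
  by rewrite C1 -!mulgA; congr (z * (x * _)); rewrite mulgA.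
have zE : z = z * x * y.
  rewrite -{1}zxz -{1}xyx.
  have -> : z * (x * y * x) * z = z * ((x * y) * (x * z)) by rewrite !mulgA.
  by rewrite C2 !mulgA zxz.
by rewrite yE -zE.
Qed.

End Presented.

Arguments presented {X} R.
Arguments pzero {X R}.
Arguments pgen {X R} x.

Section Universal.
Variables (X : Type) (R : iterm X -> iterm X -> Prop).
Variables (S : semigroupType) (inv : S -> S) (z : S).
Hypotheses (invP : is_inverse_op inv) (zP : is_zero z).

Fixpoint ieval (f : X -> S) (t : iterm X) : S :=
  match t with
  | TZero => z
  | TGen x => f x
  | TMul s t => ieval f s * ieval f t
  | TInv s => inv (ieval f s)
  end.

Let mulVm x : x * inv x * x = x. Proof. by case: ((invP x (inv x)).2 erefl). Qed.
Let mulmV x : inv x * x * inv x = inv x.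
Proof. by case: ((invP x (inv x)).2 erefl). Qed.
Let invU x y : x * y * x = x -> y * x * y = y -> y = inv x.
Proof. by move=> h1 h2; apply/invP. Qed.
Let invK x : inv (inv x) = x. Proof. by apply/esym/invU. Qed.
Let inv_idem e : e * e = e -> inv e = e.
Proof. by move=> ee; apply/esym/invU; rewrite !ee. Qed.

Let idemM (e f : S) : e * e = e -> f * f = f -> (e * f) * (e * f) = e * f.
Proof.
move=> ee ff; set g := inv (e * f).
have r1 : e * f * g * (e * f) = e * f := mulVm _.
have r2 : g * (e * f) * g = g := mulmV _.
have gE : f * g * e = g.
  apply: invU; rewrite !mulgA.
    by rewrite -[e * f * f]mulgA ff -[_ * e * e]mulgA ee -mulgA r1.
  rewrite -[f * g * e * e]mulgA ee -[f * g * e * f * f]mulgA ff.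
  have -> : f * g * e * f * g * e = f * (g * (e * f) * g) * e by rewrite !mulgA.
  by rewrite r2.
have gg : g * g = g.
  rewrite -{1 2}gE.
  have -> : f * g * e * (f * g * e) = f * (g * (e * f) * g) * e by rewrite !mulgA.
  by rewrite r2.
by rewrite -{3}[e * f]invK -/g (inv_idem gg) -{1 2}[e * f]invK -/g (inv_idem gg).
Qed.

Let idemC (e f : S) : e * e = e -> f * f = f -> e * f = f * e.
Proof.
move=> ee ff; rewrite -[e * f]inv_idem ?idemM //; apply/esym/invU.
  have -> : e * f * (f * e) * (e * f) = e * (f * f) * (e * e) * f.
    by rewrite !mulgA.
  by rewrite ee ff -[RHS]idemM // !mulgA.
have -> : f * e * (e * f) * (f * e) = f * (e * e) * (f * f) * e by rewrite !mulgA.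
by rewrite ee ff -[RHS]idemM // !mulgA.
Qed.

Let idemV (x : S) : (x * inv x) * (x * inv x) = x * inv x.
Proof. by rewrite mulgA mulVm. Qed.

Let idemV' (x : S) : (inv x * x) * (inv x * x) = inv x * x.
Proof. by rewrite mulgA mulmV. Qed.

Let inv_mul (x y : S) : inv (x * y) = inv y * inv x.
Proof.
have C := idemC (idemV y) (idemV' x).
apply/esym/invU.
  have -> : x * y * (inv y * inv x) * (x * y) =
            x * ((y * inv y) * (inv x * x)) * y by rewrite !mulgA.
  by rewrite C !mulgA mulVm -!mulgA; congr (_ * _); rewrite mulgA.
have -> : inv y * inv x * (x * y) * (inv y * inv x) =
          inv y * ((inv x * x) * (y * inv y)) * inv x by rewrite !mulgA.
by rewrite -C !mulgA mulmV -!mulgA; congr (_ * _); rewrite mulgA.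
Qed.

Theorem presented_universal (f : X -> S) :
  (forall s t, R s t -> ieval f s = ieval f t) ->
  exists h : presented R -> S,
    [/\ {morph h : a b / a * b}, h pzero = z, forall x, h (pgen x) = f x
      & forall h' : presented R -> S,
          {morph h' : a b / a * b} -> h' pzero = z ->
          (forall x, h' (pgen x) = f x) -> h' =1 h].
Proof.
move=> fR.
have ev s t : icong R s t -> ieval f s = ieval f t.
  elim=> //=.
  - by move=> ? ? ? _ -> _ ->.
  - by move=> ? ? ? ? _ -> _ ->.
  - by move=> ? ? _ ->.
  - by move=> *; exact: mulgA.
  - by move=> s0; case: (zP (ieval f s0)).
  - by move=> s0; case: (zP (ieval f s0)).
  - by move=> *; exact: idemC.
pose h (a : presented R) := ieval f (repr a).
have hE t : h (pcls R t) = ieval f t by exact/ev/repr_pcls.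
exists h; split.
- by elim/pcls_ind=> s; elim/pcls_ind=> t; rewrite pclsM !hE.
- by rewrite hE.
- by move=> x; rewrite hE.
- move=> h' hM h0 hg; elim/pcls_ind=> t; rewrite hE.
  elim: t => //= [s IHs t IHt|s IHs]; first by rewrite -pclsM hM IHs IHt.
  rewrite -pinvE -IHs; apply: invU; rewrite -!hM.
    by congr h'; case: ((pinvP (pcls R s) _).2 erefl).
  by congr h'; case: ((pinvP (pcls R s) _).2 erefl).
Qed.

End Universal.

Lemma bijective_sig (A B : Type) (f : A -> B) :
  bijective f -> {g : B -> A | cancel f g & cancel g f}.
Proof. by move=> bf; apply/cid2; case: bf => g; exists g. Qed.

Section SemigroupAut.
Variable S : semigroupType.

Record sgaut : Type := SgAut {
  sgaut_fun :> S -> S;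
  sgaut_bij : bijective sgaut_fun;
  sgautM : {morph sgaut_fun : x y / x * y} }.

HB.instance Definition _ := gen_eqMixin sgaut.
HB.instance Definition _ := gen_choiceMixin sgaut.

Lemma sgaut_eq (f g : sgaut) : f =1 g -> f = g.
Proof.
case: f g => [f fb fM] [g gb gM] /= /funext fg; subst g.
by congr SgAut; exact: Prop_irrelevance.
Qed.

Definition sgaut_one : sgaut :=
  @SgAut id (Bijective (fun=> erefl) (fun=> erefl)) (fun _ _ => erefl).

Lemma sgaut_mulM (f g : sgaut) : {morph f \o g : x y / x * y}.
Proof. by move=> x y /=; rewrite !sgautM. Qed.

Definition sgaut_mul (f g : sgaut) : sgaut :=
  SgAut (bij_comp (sgaut_bij f) (sgaut_bij g)) (sgaut_mulM f g).

Definition sgaut_inv_fun (f : sgaut) : S -> S :=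
  s2val (bijective_sig (sgaut_bij f)).

Lemma sgaut_funK (f : sgaut) : cancel f (sgaut_inv_fun f).
Proof. by rewrite /sgaut_inv_fun; case: bijective_sig. Qed.

Lemma sgaut_inv_funK (f : sgaut) : cancel (sgaut_inv_fun f) f.
Proof. by rewrite /sgaut_inv_fun; case: bijective_sig. Qed.

Lemma sgaut_invM (f : sgaut) : {morph sgaut_inv_fun f : x y / x * y}.
Proof.
move=> x y; apply: (can_inj (sgaut_funK f)).
by rewrite sgautM !sgaut_inv_funK.
Qed.

Definition sgaut_inv (f : sgaut) : sgaut :=
  SgAut (Bijective (sgaut_inv_funK f) (sgaut_funK f)) (sgaut_invM f).

Lemma sgaut_mulA : associative sgaut_mul.
Proof. by move=> f g h; exact: sgaut_eq. Qed.
Lemma sgaut_mul1 : left_id sgaut_one sgaut_mul.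
Proof. by move=> f; exact: sgaut_eq. Qed.
Lemma sgaut_1mul : right_id sgaut_one sgaut_mul.
Proof. by move=> f; exact: sgaut_eq. Qed.
Lemma sgaut_mulVf : left_inverse sgaut_one sgaut_inv sgaut_mul.
Proof. by move=> f; apply: sgaut_eq => x /=; rewrite sgaut_funK. Qed.
Lemma sgaut_mulfV : right_inverse sgaut_one sgaut_inv sgaut_mul.
Proof. by move=> f; apply: sgaut_eq => x /=; rewrite sgaut_inv_funK. Qed.

HB.instance Definition _ := isGroup.Build sgaut
  sgaut_mulA sgaut_mul1 sgaut_1mul sgaut_mulVf sgaut_mulfV.

End SemigroupAut.

Record digraph : Type := Digraph {
  vertex : Type;
  edge : Type;
  src : edge -> vertex;
  rng : edge -> vertex }.

Record sepgraph : Type := SepGraph {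
  sg_graph :> digraph;
  blocks : vertex sg_graph -> set (set (edge sg_graph));
  blocksP : forall v,
    partition (blocks v) id (@src sg_graph @^-1` [set v]) }.

Definition separation (E : sepgraph) : set (set (edge E)) :=
  \bigcup_v @blocks E v.

Section SeparationTheory.
Variable E : sepgraph.

Lemma separation_neq0 (Z : set (edge E)) : separation Z -> Z !=set0.
Proof. by case=> v _ Zv; case: (blocksP v) => _ _; exact. Qed.

Lemma separation_ex (e : edge E) : exists2 Z, separation Z & Z e.
Proof.
have : (@src E @^-1` [set src e]) e by [].
case: (blocksP (src e)) => <- _ _ [Z Zv Ze]; exists Z => //.
by exists (src e).
Qed.

Lemma separation_uniq (Y Z : set (edge E)) (e : edge E) :
  separation Y -> separation Z -> Y e -> Z e -> Y = Z.
Proof.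
have srcE v W : @blocks E v W -> W e -> src e = v.
  by case: (blocksP v) => c _ _ vW We; have : cover (@blocks E v) id e; [exists W | rewrite c].
move=> [v _ Yv] [w _ Zw] Ye Ze.
have vw : v = w by rewrite -(srcE _ _ Yv Ye) (srcE _ _ Zw Ze).
subst w; case: (blocksP v) => _ /(_ Y Z Yv Zw) + _; apply.
by exists e.
Qed.

End SeparationTheory.

Section SeparatedGraphAut.
Variable E : sepgraph.

Record sepaut : Type := SepAut {
  autv : vertex E -> vertex E;
  aute : edge E -> edge E;
  autv_bij : bijective autv;
  aute_bij : bijective aute;
  aut_src : forall e, src (aute e) = autv (src e);
  aut_rng : forall e, rng (aute e) = autv (rng e);
  aut_sep : forall Z : set (edge E), separation Z -> separation (aute @` Z) }.

HB.instance Definition _ := gen_eqMixin sepaut.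
HB.instance Definition _ := gen_choiceMixin sepaut.

Lemma sepaut_eq (f g : sepaut) : autv f =1 autv g -> aute f =1 aute g -> f = g.
Proof.
case: f g => [f0 f1 ? ? ? ? ?] [g0 g1 ? ? ? ? ?] /= /funext e0 /funext e1.
by subst g0 g1; congr SepAut; exact: Prop_irrelevance.
Qed.

Lemma sepaut_one_sep (Z : set (edge E)) : separation Z -> separation (id @` Z).
Proof. by rewrite image_id. Qed.

Definition sepaut_one : sepaut :=
  @SepAut id id (Bijective (fun=> erefl) (fun=> erefl))
    (Bijective (fun=> erefl) (fun=> erefl)) (fun=> erefl) (fun=> erefl)
    sepaut_one_sep.

Section Mul.
Variables f g : sepaut.

Lemma sepaut_mul_src e : src ((aute f \o aute g) e) = (autv f \o autv g) (src e).
Proof. by rewrite /= !aut_src. Qed.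

Lemma sepaut_mul_rng e : rng ((aute f \o aute g) e) = (autv f \o autv g) (rng e).
Proof. by rewrite /= !aut_rng. Qed.

Lemma sepaut_mul_sep (Z : set (edge E)) :
  separation Z -> separation ((aute f \o aute g) @` Z).
Proof. by move=> CZ; rewrite -image_comp; do 2!apply: aut_sep. Qed.

Definition sepaut_mul : sepaut :=
  SepAut (bij_comp (autv_bij f) (autv_bij g)) (bij_comp (aute_bij f) (aute_bij g))
    sepaut_mul_src sepaut_mul_rng sepaut_mul_sep.
End Mul.

Section Inv.
Variable f : sepaut.

Definition inv_autv : vertex E -> vertex E := s2val (bijective_sig (autv_bij f)).
Definition inv_aute : edge E -> edge E := s2val (bijective_sig (aute_bij f)).

Lemma autvK : cancel (autv f) inv_autv.
Proof. by rewrite /inv_autv; case: bijective_sig. Qed.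
Lemma inv_autvK : cancel inv_autv (autv f).
Proof. by rewrite /inv_autv; case: bijective_sig. Qed.
Lemma auteK : cancel (aute f) inv_aute.
Proof. by rewrite /inv_aute; case: bijective_sig. Qed.
Lemma inv_auteK : cancel inv_aute (aute f).
Proof. by rewrite /inv_aute; case: bijective_sig. Qed.

Lemma sepaut_inv_src e : src (inv_aute e) = inv_autv (src e).
Proof. by apply: (can_inj autvK); rewrite -aut_src inv_auteK inv_autvK. Qed.

Lemma sepaut_inv_rng e : rng (inv_aute e) = inv_autv (rng e).
Proof. by apply: (can_inj autvK); rewrite -aut_rng inv_auteK inv_autvK. Qed.

Lemma sepaut_inv_sep (Z : set (edge E)) :
  separation Z -> separation (inv_aute @` Z).
Proof.
move=> CZ; have [e Ze] := separation_neq0 CZ.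
have [Y CY Ye] := separation_ex (inv_aute e).
have -> : Z = aute f @` Y.
  apply: (separation_uniq CZ (aut_sep f CY) Ze).
  by exists (inv_aute e); rewrite ?inv_auteK.
rewrite image_comp (_ : _ @` Y = Y) //.
by rewrite -[RHS]image_id; apply: eq_imagel => x _ /=; rewrite auteK.
Qed.

Definition sepaut_inv : sepaut :=
  SepAut (Bijective inv_autvK autvK) (Bijective inv_auteK auteK)
    sepaut_inv_src sepaut_inv_rng sepaut_inv_sep.
End Inv.

Lemma sepaut_mulA : associative sepaut_mul.
Proof. by move=> f g h; exact: sepaut_eq. Qed.
Lemma sepaut_mul1 : left_id sepaut_one sepaut_mul.
Proof. by move=> f; exact: sepaut_eq. Qed.
Lemma sepaut_1mul : right_id sepaut_one sepaut_mul.
Proof. by move=> f; exact: sepaut_eq. Qed.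
Lemma sepaut_mulVf : left_inverse sepaut_one sepaut_inv sepaut_mul.
Proof. by move=> f; apply: sepaut_eq => x /=; rewrite ?autvK ?auteK. Qed.
Lemma sepaut_mulfV : right_inverse sepaut_one sepaut_inv sepaut_mul.
Proof. by move=> f; apply: sepaut_eq => x /=; rewrite ?inv_autvK ?inv_auteK. Qed.

HB.instance Definition _ := isGroup.Build sepaut
  sepaut_mulA sepaut_mul1 sepaut_1mul sepaut_mulVf sepaut_mulfV.

End SeparatedGraphAut.

Section SeparatedGraphSemigroup.
Variable E : sepgraph.

Inductive dedge : Type :=
| Edge of edge E
| EdgeInv of edge E.

Definition dsrc (x : dedge) : vertex E :=
  match x with Edge e => src e | EdgeInv e => rng e end.

Definition drng (x : dedge) : vertex E :=
  match x with Edge e => rng e | EdgeInv e => src e end.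

Inductive generator : Type :=
| Vert of vertex E
| DEdge of dedge.

Let V (v : vertex E) : iterm generator := TGen (Vert v).
Let D (x : dedge) : iterm generator := TGen (DEdge x).

(* The formal inverse [EdgeInv e] is a generator, distinct as a term from the
   inverse-semigroup inverse of [Edge e]; the relations identify the two. *)
Inductive sep_rel : iterm generator -> iterm generator -> Prop :=
| rel_vv v : sep_rel (TMul (V v) (V v)) (V v)
| rel_vw v w : v <> w -> sep_rel (TMul (V v) (V w)) TZero
| rel_src x : sep_rel (TMul (V (dsrc x)) (D x)) (D x)
| rel_rng x : sep_rel (TMul (D x) (V (drng x))) (D x)
| rel_ee Z e : separation Z -> Z e ->
    sep_rel (TMul (D (EdgeInv e)) (D (Edge e))) (V (rng e))
| rel_ef Z e f : separation Z -> Z e -> Z f -> e <> f ->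
    sep_rel (TMul (D (EdgeInv e)) (D (Edge f))) TZero.

Definition sepS : Type := presented sep_rel.
HB.instance Definition _ := Semigroup.on sepS.

Definition sepS0 : sepS := pzero.
Definition sepSv (v : vertex E) : sepS := pgen (Vert v).
Definition sepSe (e : edge E) : sepS := pgen (DEdge (Edge e)).
Definition sepSi (e : edge E) : sepS := pgen (DEdge (EdgeInv e)).

Lemma sepSiE e : sepSi e = pinv (sepSe e).
Proof.
have rel s t : sep_rel s t -> pcls sep_rel s = pcls sep_rel t.
  by move=> h; apply/pclsP; exact: icong_rel.
have [Z CZ Ze] := separation_ex e.
have ie : sepSi e * sepSe e = sepSv (rng e).
  by rewrite [LHS]pclsM; apply: rel; exact: (rel_ee CZ Ze).
apply/pinvP; split.
  by rewrite -mulgA ie [LHS]pclsM; apply: rel; exact: (rel_rng (Edge e)).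
by rewrite ie [LHS]pclsM; apply: rel; exact: (rel_src (EdgeInv e)).
Qed.

End SeparatedGraphSemigroup.

Arguments sepS0 {E}.

(* Main.v *)
Require Import Defs.
From mathcomp Require Import all_boot.
From mathcomp Require Import boolp classical_sets.

(** An automorphism of the graph permutes generators compatibly with the
    defining relations, so it induces an automorphism of the semigroup
    [sepS E] by the universal property. The content of the theorem is that
    nothing else is an automorphism: the vertices, the edges and the separation
    can all be recovered from the multiplication of [sepS E] alone.

    Vertices are the maximal nonzero idempotents: every nonzero element is fixed
    by left multiplication by some vertex, and distinct vertices are orthogonal.
    Hence an automorphism permutes the vertices ([sep_aut_vert]).

    Paths of the graph (vertices, and products of edges without formal inverses)
    are the elements [a] for which [pinv a * a] is a vertex ([pathV_path] and
    [pinv_mul_eq_vert]). Since automorphisms preserve the generalized inverse,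
    they permute the paths. The edges are the paths of positive length
    that are not a product of two such, so they are permuted too
    ([sep_aut_edge]). Source and range follow, as [src e] is the vertex [v] with
    [v * e = e] and [rng e] is [pinv e * e].

    For edges [e], [f] with a common source, [pinv e * f = 0] holds exactly when
    [e] and [f] are distinct edges of one block ([same_blockP]), so the
    separation is recovered as well.

    These characterizations need elements of [sepS E] to be shown nonzero or
    distinct. That is done with an action by partial bijections on pairs
    (vertex, list of labels), where the edge [e] sends [(rng e, q)] to
    [(src e, lam e :: q)]. It respects the relations whenever the labelling
    [lam] is injective on each block. With [lam = id], the element given by a
    path with range [v] sends [(v, [::])] to its list of edges, so paths are
    faithfully represented. With a labelling that identifies one edge from each
    of two different blocks, [pinv e * f] is seen to be nonzero for these two
    edges if they have a common source. *)

Set Implicit Arguments.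
Unset Strict Implicit.
Unset Printing Implicit Defensive.

Local Open Scope classical_set_scope.
Local Open Scope group_scope.

(** * Morphisms of presented inverse semigroups *)

Section InverseSemigroupMorphism.
Variables (X Y : Type).
Variables (R : iterm X -> iterm X -> Prop) (Q : iterm Y -> iterm Y -> Prop).

(** Generalized inverses are unique, so a multiplicative map preserves them. *)
Lemma morph_pinv (h : presented R -> presented Q) (a : presented R) :
  {morph h : a b / a * b} -> h (pinv a) = pinv (h a).
Proof. by move=> hM; apply/pinvP; rewrite -!hM pmulVm pVmulm. Qed.

Lemma pinv0 : pinv pzero = pzero :> presented R.
Proof. by apply/esym/pinvP; rewrite !(pzeroP _).1. Qed.

Lemma morph_presented_eq (h k : presented R -> presented Q) :
  {morph h : a b / a * b} -> {morph k : a b / a * b} ->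
  h pzero = k pzero -> (forall x, h (pgen x) = k (pgen x)) -> h =1 k.
Proof.
move=> hM kM hk0 hkg; elim/pcls_ind; elim=> // [s IHs t IHt|s IHs].
  by rewrite -pclsM hM kM IHs IHt.
by rewrite -pinvE !morph_pinv // IHs.
Qed.

End InverseSemigroupMorphism.

Lemma pinv_idem (X : Type) (R : iterm X -> iterm X -> Prop) (e : presented R) :
  e * e = e -> pinv e = e.
Proof. by move=> ee; apply/esym/pinvP; rewrite !ee. Qed.

Lemma sgaut0 (S : semigroupType) (z : S) (g : sgaut S) : is_zero z -> g z = z.
Proof.
move=> z0; rewrite -[RHS](z0 (g z)).1 -[z in z * _](sgaut_inv_funK g).
by rewrite -sgautM (z0 _).2.
Qed.

(** * The defining relations and a normal form *)

Section Relations.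
Variable E : sepgraph.
Implicit Types (v w : vertex E) (e f : edge E) (a b : sepS E).

Let rel s t : sep_rel s t -> pcls (@sep_rel E) s = pcls (@sep_rel E) t.
Proof. by move=> h; apply/pclsP; exact: icong_rel. Qed.

Definition same_block e f := exists Z, [/\ separation Z, Z e & Z f].

Lemma same_block_refl e : same_block e e.
Proof. by have [Z CZ Ze] := separation_ex e; exists Z. Qed.

Lemma same_block_src e f : same_block e f -> src e = src f.
Proof.
move=> [Z [[v _ vZ] Ze Zf]]; have srcE x : Z x -> src x = v.
  by move=> Zx; have [c _ _] := blocksP v; move: c => /seteqP[/(_ x) + _]; apply; exists Z.
by rewrite !srcE.
Qed.

Lemma mul0S a : sepS0 * a = sepS0. Proof. exact: (pzeroP a).1. Qed.
Lemma mulS0 a : a * sepS0 = sepS0. Proof. exact: (pzeroP a).2. Qed.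

Lemma vertvv v : sepSv v * sepSv v = sepSv v.
Proof. rewrite [LHS]pclsM; exact/rel/rel_vv. Qed.

Lemma vertvw v w : v <> w -> sepSv v * sepSv w = sepS0.
Proof. by move=> vw; rewrite [LHS]pclsM; apply/rel/rel_vw. Qed.

Lemma src_edge e : sepSv (src e) * sepSe e = sepSe e.
Proof. rewrite [LHS]pclsM; exact/rel/(rel_src (Edge e)). Qed.
Lemma edge_rng e : sepSe e * sepSv (rng e) = sepSe e.
Proof. rewrite [LHS]pclsM; exact/rel/(rel_rng (Edge e)). Qed.
Lemma rng_edgeV e : sepSv (rng e) * sepSi e = sepSi e.
Proof. rewrite [LHS]pclsM; exact/rel/(rel_src (EdgeInv e)). Qed.
Lemma edgeV_src e : sepSi e * sepSv (src e) = sepSi e.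
Proof. rewrite [LHS]pclsM; exact/rel/(rel_rng (EdgeInv e)). Qed.

Lemma edgeV_edge e : sepSi e * sepSe e = sepSv (rng e).
Proof.
by have [Z CZ Ze] := separation_ex e; rewrite [LHS]pclsM; apply/rel/(rel_ee CZ Ze).
Qed.

Lemma same_block_edgeV_edge e f :
  same_block e f -> e <> f -> sepSi e * sepSe f = sepS0.
Proof.
by move=> [Z [CZ Ze Zf]] ef; rewrite [LHS]pclsM; apply/rel/(rel_ef CZ Ze Zf).
Qed.

Lemma pinv_vert v : pinv (sepSv v) = sepSv v.
Proof. exact/pinv_idem/vertvv. Qed.

Lemma pinv_edge e : pinv (sepSe e) = sepSi e.
Proof. by rewrite sepSiE. Qed.
Lemma pinv_edgeV e : pinv (sepSi e) = sepSe e.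
Proof. by rewrite sepSiE; exact: pinvK. Qed.

(** [sepS E] has no unit in general; vertices serve as local units instead. *)
Lemma sep_local_units a :
  a = sepS0 \/ exists v w, sepSv v * a = a /\ a * sepSv w = a.
Proof.
elim/pcls_ind: a; elim=> [|x|s IHs t IHt|s IHs].
- by left.
- right; case: x => [v|[e|e]].
  + by exists v, v; split; exact: vertvv.
  + by exists (src e), (rng e); split; [exact: src_edge|exact: edge_rng].
  + by exists (rng e), (src e); split; [exact: rng_edgeV|exact: edgeV_src].
- rewrite -pclsM; case: IHs => [->|[v [_ [vs _]]]].
    by left; exact: mul0S.
  case: IHt => [->|[_ [w [_ tw]]]].
    by left; exact: mulS0.
  right; exists v, w; split; first by rewrite mulgA; congr (_ * _).
  by rewrite -mulgA; congr (_ * _).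
- rewrite -pinvE; case: IHs => [->|[v [w [vs sw]]]].
    by left; exact: pinv0.
  right; exists w, v; rewrite -(pinv_vert v) -(pinv_vert w).
  by split; rewrite -[LHS]pinvM; congr pinv.
Qed.

Fixpoint ispath u (p : seq (edge E)) v : Prop :=
  if p is e :: p' then src e = u /\ ispath (rng e) p' v else u = v.

(** The final vertex makes the empty list at [v] stand for the vertex [v]. *)
Definition pathS (p : seq (edge E)) v : sepS E :=
  foldr (fun e a => sepSe e * a) (sepSv v) p.

Lemma src_path u p v : ispath u p v -> sepSv u * pathS p v = pathS p v.
Proof.
case: p => [->|e p [<- _]] /=; first exact: vertvv.
by rewrite mulgA src_edge.
Qed.

(** The product telescopes from the middle, each [sepSi e * sepSe e] being the
    source of what remains of the path. *)
Lemma pathV_path u p v : ispath u p v -> pinv (pathS p v) * pathS p v = sepSv v.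
Proof.
elim: p u => [|e p IHp] u /=; first by rewrite pinv_vert vertvv.
move=> [_ pv]; rewrite [pinv _]pinvM -/(pathS p v) pinv_edge.
by rewrite -mulgA [sepSi e * _]mulgA edgeV_edge (src_path pv) (IHp _ pv).
Qed.

(** An incomplete normal form: after cancelling, a nonzero element is a path
    or contains a formal inverse, and then what follows the last inverse is a
    path that does not start with the inverted edge. The prefix [b] is
    arbitrary, which is what makes the alternative stable under left
    multiplication; knowing the tail is enough for [pinv_mul_eq_vert]. *)
Variant path_spec a : Prop :=
| PathZero of a = sepS0
| PathPos u p v of ispath u p v & a = pathS p v
| PathMixed b e u p v of ispath u p v & ohead p <> Some e
    & a = b * sepSi e * pathS p v.

Lemma path_spec_vert v a : path_spec a -> path_spec (sepSv v * a).
Proof.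
case=> [->|u p w pp ->|b e u p w pp pe ->].
- by apply: PathZero; rewrite mulS0.
- have [->|vu] := pselect (v = u).
    by rewrite (src_path pp); exact: PathPos pp _.
  by apply: PathZero; rewrite -(src_path pp) mulgA vertvw // mul0S.
- by apply: (PathMixed (b := sepSv v * b) pp pe); rewrite !mulgA.
Qed.

Lemma path_spec_edge f a : path_spec a -> path_spec (sepSe f * a).
Proof.
case=> [->|u p w pp ->|b e u p w pp pe ->].
- by apply: PathZero; rewrite mulS0.
- have [ru|ru] := pselect (rng f = u).
    by apply: (@PathPos _ (src f) (f :: p) w) => //=; rewrite ru.
  apply: PathZero; rewrite -(src_path pp) -edge_rng -mulgA.
  by rewrite [sepSv _ * (_ * _)]mulgA vertvw // mul0S mulS0.
- by apply: (PathMixed (b := sepSe f * b) pp pe); rewrite !mulgA.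
Qed.

Lemma path_spec_edgeV f a : path_spec a -> path_spec (sepSi f * a).
Proof.
case=> [->|u p w pp ->|b e u p w pp pe ->].
- by apply: PathZero; rewrite mulS0.
- have [pf|pf] := pselect (ohead p = Some f).
    case: p pf pp => //= _ p [->] [_ pp].
    rewrite mulgA edgeV_edge -/(pathS p w) (src_path pp).
    exact: PathPos pp _.
  by apply: (PathMixed (b := sepSv (rng f)) pp pf); rewrite rng_edgeV.
- by apply: (PathMixed (b := sepSi f * b) pp pe); rewrite !mulgA.
Qed.

(** The inverse terms are handled together with the terms, because [path_spec]
    is not symmetric under inversion. *)
Lemma path_spec_mul a b : path_spec b -> path_spec (a * b).
Proof.
suff: (forall b, path_spec b -> path_spec (a * b)) /\
      (forall b, path_spec b -> path_spec ((pinv a : sepS E) * b)).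
  by case=> + _; exact.
elim/pcls_ind: a {b}; elim=> [|x|s [IHs IHs'] t [IHt IHt']|s [IHs IHs']].
- have z b : path_spec (sepS0 * b) by apply: PathZero; exact: mul0S.
  by split=> b _; rewrite ?pinv0; exact: z.
- case: x => [v|[e|e]]; split=> b sb.
  + exact: (path_spec_vert v).
  + by have := path_spec_vert v sb; rewrite -{1}pinv_vert.
  + exact: (path_spec_edge e).
  + by have := path_spec_edgeV e sb; rewrite -{1}pinv_edge.
  + exact: (path_spec_edgeV e).
  + by have := path_spec_edge e sb; rewrite -{1}pinv_edgeV.
- rewrite -pclsM pinvM; split=> b sb; rewrite -mulgA.
    by apply/IHs/IHt.
  by apply/IHt'/IHs'.
- by rewrite -pinvE pinvK; split.
Qed.

Lemma path_specP a : path_spec a.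
Proof.
have [->|[_ [w [_ <-]]]] := sep_local_units a; first exact: PathZero.
by apply: path_spec_mul; exact: (@PathPos _ w [::] w).
Qed.

End Relations.

(** * An action by partial bijections *)

Section Action.
Variables (E : sepgraph) (lam : edge E -> edge E).
Hypothesis lam_inj : forall e f, same_block e f -> lam e = lam f -> e = f.

Let point := (vertex E * seq (edge E))%type.

(** Relations are read from right to left: [gen_act g x y] says that [g] sends
    [y] to [x], so that products become compositions. *)
Definition gen_act (g : generator E) (x y : point) : Prop :=
  match g with
  | Vert v => y.1 = v /\ x = y
  | DEdge (Edge e) => y.1 = rng e /\ x = (src e, lam e :: y.2)
  | DEdge (EdgeInv e) => x.1 = rng e /\ y = (src e, lam e :: x.2)
  end.

Fixpoint term_act (t : iterm (generator E)) (x y : point) : Prop :=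
  match t with
  | TZero => False
  | TGen g => gen_act g x y
  | TMul s t => exists2 z, term_act s x z & term_act t z y
  | TInv s => term_act s y x
  end.

(** Every term acts as a partial bijection: the relation is functional in both
    directions. *)
Lemma term_act_inj t x y x' y' :
  term_act t x y -> term_act t x' y' -> x = x' <-> y = y'.
Proof.
elim: t x y x' y' => [|g|s IHs t IHt|s IHs] x y x' y' //=.
- case: g => [v|[e|e]] /=.
  + by move=> [_ ->] [_ ->].
  + case: x y x' y' => [? ?] [? ?] [? ?] [? ?] /= [-> [-> ->]] [-> [-> ->]].
    by split=> [[->]|[->]].
  + case: x y x' y' => [? ?] [? ?] [? ?] [? ?] /= [-> [-> ->]] [-> [-> ->]].
    by split=> [[->]|[->]].
- move=> [z sz tz] [z' sz' tz'].
  by rewrite (IHs _ _ _ _ sz sz'); exact: IHt tz tz'.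
- by move=> h h'; split=> /(IHs _ _ _ _ h h').
Qed.

Lemma term_act_rel s t x y :
  sep_rel s t -> term_act s x y <-> term_act t x y.
Proof.
case=> [v|v w vw|[e|e]|[e|e]|Z e _ _|Z e f CZ Ze Zf ef] /=.
- by split=> [[_ [? ->] []]|[? ->]] //; exists y.
- by split=> // -[z [zv _] [yw zy]]; case: vw; rewrite -zv -yw zy.
- by split=> [[z [_ ->]] //|[ye ->]]; exists (src e, lam e :: y.2).
- split=> [[z [ze yE] [_ ->]]|[xe ->]]; last by exists x.
  by rewrite yE.
- by split=> [[z [ze zx] [_ <-]] //|[ye ->]]; exists y.
- by split=> [[z [ze zx] [_ <-]] //|[xe ->]]; exists (src e, lam e :: x.2).
- case: x y => [u p] [w q] /=; split=> [[z [ue zp] [we]]|[-> [-> ->]]].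
    by rewrite zp ue we => -[->].
  by exists (src e, lam e :: q).
- split=> // -[z [_ ->] [_ [_ lef _]]]; apply: ef; apply: lam_inj lef.
  by exists Z.
Qed.

(** The action factors through [sepS E]. Partial bijections satisfy the axioms of
    inverse semigroups; in particular, [s * pinv s] acts as the identity of the
    range of [s], and such partial identities commute. *)
Lemma term_act_icong s t :
  icong (@sep_rel E) s t -> forall x y, term_act s x y <-> term_act t x y.
Proof.
elim=> {s t} /=.
- by move=> s t st x y; exact: term_act_rel.
- by [].
- by move=> s t _ IH x y; rewrite IH.
- by move=> s t u _ IH1 _ IH2 x y; rewrite IH1.
- move=> s s' t t' _ IHs _ IHt x y.
  by split=> -[z sz tz]; exists z; first [exact/IHs|exact/IHt].
- by move=> s s' _ IH x y.
- move=> s t u x y; split=> [[z sz [z' tz uz]]|[z [z' sz tz] uz]].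
    by exists z' => //; exists z.
  by exists z' => //; exists z.
- by move=> s x y; split=> // -[].
- by move=> s x y; split=> // -[].
- by [].
- by move=> s t x y; split=> -[z]; exists z.
- move=> s x y; split=> [[z [z' sz sz'] szy]|sxy].
    by have /(term_act_inj sz szy)-> : z' = y by apply/(term_act_inj sz' szy).
  by exists x => //; exists y.
- have idE s x z : (exists2 z', term_act s x z' & term_act s z z') <->
                   x = z /\ exists z', term_act s x z'.
    split=> [[z' sx sz]|[<- [z' sx]]]; last by exists z'.
    by split; [exact/(term_act_inj sx sz)|exists z'].
  move=> s t x y; split=> -[z /idE[<- sx] /idE[<- tx]].
    by exists x; exact/idE.
  by exists x; exact/idE.
Qed.

Definition act (a : sepS E) (x y : point) : Prop := term_act (repr a) x y.

Lemma act_pcls t x y : act (pcls _ t) x y <-> term_act t x y.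
Proof. exact/term_act_icong/repr_pcls. Qed.

Lemma act0 x y : ~ act sepS0 x y.
Proof. by move/act_pcls. Qed.

Lemma act_gen g x y : act (pgen g) x y <-> gen_act g x y.
Proof. exact: act_pcls. Qed.

Lemma actM (a b : sepS E) x y :
  act (a * b) x y <-> exists2 z, act a x z & act b z y.
Proof. exact: act_pcls. Qed.

Lemma act_path u p v x y : ispath u p v ->
  act (pathS p v) x y <-> exists q, y = (v, q) /\ x = (u, map lam p ++ q).
Proof.
elim: p u x y => [|e p IHp] u x y /=.
  move=> ->; rewrite act_gen; case: y => w q /=.
  by split=> [[-> ->]|[r [[-> ->] ->]]] //; exists q.
move=> [<- pv]; rewrite actM; split=> [[z]|[q [-> ->]]].
  by rewrite act_gen (IHp _ _ _ pv) => -[_ ->] [q [-> ->]]; exists q.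
exists (rng e, map lam p ++ q); first by rewrite act_gen.
by rewrite (IHp _ _ _ pv); exists q.
Qed.

End Action.

(** * Recognizing paths and blocks in the semigroup *)

Section NormalForms.
Variable E : sepgraph.
Implicit Types (v w : vertex E) (e f : edge E) (p q : seq (edge E)).
Implicit Types (a b : sepS E).

Lemma id_inj_on_blocks e f : same_block e f -> id e = id f -> e = f.
Proof. by []. Qed.

(** A path is recovered from its action, as it sends the empty list to itself. *)
Lemma pathS_inj u p v u' p' v' : ispath u p v -> ispath u' p' v' ->
  pathS p v = pathS p' v' -> [/\ u = u', p = p' & v = v'].
Proof.
move=> pv pv' pp'.
have : act id (pathS p v) (u, p) (v, [::]).
  by rewrite (act_path id_inj_on_blocks _ _ pv); exists [::]; rewrite cats0 map_id.
rewrite pp' (act_path id_inj_on_blocks _ _ pv') => -[q [[-> <-]]].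
by rewrite cats0 map_id => -[-> ->].
Qed.

Lemma pathS_neq0 u p v : ispath u p v -> pathS p v <> sepS0.
Proof.
move=> pv p0; apply: (@act0 _ id id_inj_on_blocks (u, p) (v, [::])).
by rewrite -p0 (act_path id_inj_on_blocks _ _ pv); exists [::]; rewrite cats0 map_id.
Qed.

Lemma vert_neq0 v : sepSv v <> sepS0.
Proof. exact: (@pathS_neq0 v [::] v). Qed.

Lemma sepSv_inj : injective (@sepSv E).
Proof. by move=> v w vw; case: (@pathS_inj v [::] v w [::] w). Qed.

Lemma edge_path e : pathS [:: e] (rng e) = sepSe e.
Proof. exact: edge_rng. Qed.

Lemma ispath1 e : ispath (src e) [:: e] (rng e).
Proof. by []. Qed.

Lemma edge_neq0 e : sepSe e <> sepS0.
Proof. by rewrite -edge_path; exact: pathS_neq0 (ispath1 e). Qed.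

Lemma sepSe_inj : injective (@sepSe E).
Proof.
move=> e f; rewrite -!edge_path.
by case/(pathS_inj (ispath1 e) (ispath1 f)) => _ [->].
Qed.

Lemma mul_vert_neq0 v w a : sepSv w * a = a -> sepSv v * a <> sepS0 -> v = w.
Proof.
move=> wa va; apply: contrapT => vw; apply: va.
by rewrite -wa mulgA vertvw // mul0S.
Qed.

Lemma vert_mul_inj v w a : a <> sepS0 ->
  sepSv v * a = a -> sepSv w * a = a -> v = w.
Proof. by move=> a0 va wa; apply: (mul_vert_neq0 wa); rewrite va. Qed.

(** The hypothesis puts the empty list at [v] into the domain of [a]. When [a]
    contains an inverse, take the last one, [sepSi e]: the path [p] after it
    sends the empty list to [p], where [sepSi e] is defined only if [p] starts
    with [e]. *)
Lemma pinv_mul_eq_vert a v : pinv a * a = sepSv v ->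
  exists u p, ispath u p v /\ a = pathS p v.
Proof.
move=> av; case: (path_specP a) => [a0|u p w pw aE|b e u p w pw pe aE].
- by case: (@vert_neq0 v); rewrite -av a0; exact: mulS0.
- have <- : w = v by apply: sepSv_inj; rewrite -av aE (pathV_path pw).
  by exists u, p.
have : act id (sepSv v) (v, [::]) (v, [::]) by exact/act_gen.
rewrite -av actM // => -[z _].
rewrite aE actM // => -[z1 /(actM id_inj_on_blocks)[z2 _]].
move=> /(act_gen id_inj_on_blocks)[_ z1E].
rewrite (act_path id_inj_on_blocks _ _ pw) => -[q [[_ <-]]].
by rewrite cats0 map_id z1E => -[_ pE]; case: pe; rewrite -pE.
Qed.

(** The separation in terms of the multiplication. If [e] and [f] were in
    different blocks, giving [f] the label of [e] would keep the labelling
    injective on blocks, while [sepSi e * sepSe f] would act as a nonempty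
    partial bijection. *)
Lemma same_blockP e f :
  same_block e f <-> src e = src f /\ (e = f \/ sepSi e * sepSe f = sepS0).
Proof.
split=> [ef|[sef [->|ef0]]]; last 2 first.
- exact: same_block_refl.
- apply: contrapT => nef.
  pose lam x := if `[< x = f >] then e else x.
  have lamf : lam f = e by rewrite /lam; case: asboolP.
  have lame : lam e = e by rewrite /lam; case: asboolP.
  have lam_inj x y : same_block x y -> lam x = lam y -> x = y.
    rewrite /lam => xy; case: asboolP => [xf|_]; case: asboolP => [yf|_] //.
    + by rewrite xf yf.
    + move=> ey; case: nef; case: xy => Z [CZ Zx Zy].
      by exists Z; rewrite ey -xf.
    + move=> xe; case: nef; case: xy => Z [CZ Zx Zy].
      by exists Z; rewrite -xe -yf.
  apply: (@act0 _ lam lam_inj (rng e, [::]) (rng f, [::])).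
  rewrite -ef0 actM //; exists (src e, [:: e]).
    by rewrite act_gen //= lame.
  by rewrite act_gen //= sef lamf.
split; first exact: same_block_src.
have [->|nef] := pselect (e = f); first by left.
by right; exact: same_block_edgeV_edge.
Qed.

End NormalForms.

(** * Automorphisms of the semigroup *)

Section Automorphisms.
Variable E : sepgraph.
Implicit Types (v w : vertex E) (e f : edge E) (p q : seq (edge E)).
Implicit Types (a b : sepS E) (g : sgaut (sepS E)) (phi : sepaut E).

Lemma pathS_cat u p v u' q w : ispath u p v -> ispath u' q w ->
  pathS p v * pathS q w <> sepS0 ->
  ispath u (p ++ q) w /\ pathS p v * pathS q w = pathS (p ++ q) w.
Proof.
move=> + qw; elim: p u => [|e p IHp] u /=.
  move=> -> vq0; have vu := mul_vert_neq0 (src_path qw) vq0; subst u'.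
  by rewrite (src_path qw).
move=> [eu pv]; rewrite -mulgA => epq0.
have [|pqw ->] := IHp _ pv; last by [].
by move=> pq0; apply: epq0; rewrite pq0 mulS0.
Qed.

Lemma sep_aut0 g : g sepS0 = sepS0.
Proof. exact/sgaut0/pzeroP. Qed.

Lemma sgaut_inv_eq g a b : g a = b -> sgaut_inv g b = a.
Proof. by move=> <-; exact: sgaut_funK. Qed.

Lemma sep_aut_neq0 g a : a <> sepS0 -> g a <> sepS0.
Proof. by move=> a0 /sgaut_inv_eq; rewrite sep_aut0 => /esym. Qed.

Lemma sep_aut_pinv g a : g (pinv a) = pinv (g a).
Proof. exact/morph_pinv/sgautM. Qed.

Lemma left_vert_unit a : a <> sepS0 -> exists v, sepSv v * a = a.
Proof. by case: (sep_local_units a) => // -[v [_ [va _]]] _; exists v. Qed.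

(** The image of [v] lies below some vertex [w]. Applying the inverse
    automorphism, [v] lies below the image of [w], which lies below some vertex;
    that vertex is [v] itself, so both inequalities are equalities. *)
Lemma sep_aut_vert g v : exists w, g (sepSv v) = sepSv w.
Proof.
have [w wg] := left_vert_unit (sep_aut_neq0 (g := g) (@vert_neq0 _ v)).
exists w; pose h := sgaut_inv g; rewrite -(sgaut_inv_funK g (sepSv w)) -/(h _).
have hvv : h (sepSv w) * sepSv v = sepSv v.
  by have := congr1 h wg; rewrite sgautM /= sgaut_funK.
have [u uh] := left_vert_unit (sep_aut_neq0 (g := h) (@vert_neq0 _ w)).
have uv : u = v.
  apply: (@vert_mul_inj _ _ _ (sepSv v)) (vertvv v); first exact: vert_neq0.
  by rewrite -hvv mulgA uh.
congr (g _); rewrite -{1}hvv -[RHS]uh uv; apply: pidem_comm; last exact: vertvv.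
by rewrite -sgautM vertvv.
Qed.

Lemma sep_aut_path g u p v : ispath u p v ->
  exists u' p' v', ispath u' p' v' /\ g (pathS p v) = pathS p' v'.
Proof.
move=> pv; have [w gv] := sep_aut_vert g v.
have [|u' [p' [pw' gp]]] := @pinv_mul_eq_vert _ (g (pathS p v)) w.
  by rewrite -sep_aut_pinv -sgautM (pathV_path pv).
by exists u', p', w.
Qed.

Lemma sep_aut_path_nil g u p v w :
  ispath u p v -> g (pathS p v) = pathS [::] w -> p = [::].
Proof.
move=> pv /sgaut_inv_eq; have [x ->] := sep_aut_vert (sgaut_inv g) w.
by case/(@pathS_inj _ x [::] x _ _ _ erefl pv).
Qed.

(** The image of an edge is a path. It has positive length because the inverse
    automorphism sends vertices to vertices, and an edge is not one. If its
    length were at least two, the inverse automorphism would write the edge as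
    a product of two paths of positive length. *)
Lemma sep_aut_edge g e : exists f, g (sepSe e) = sepSe f.
Proof.
have [u [p [v [pv ge]]]] := sep_aut_path g (ispath1 e).
rewrite edge_path in ge; pose h := sgaut_inv g.
case: p pv ge => [|f p] pv ge.
  by move: ge; rewrite -edge_path => /(sep_aut_path_nil (ispath1 e)).
have pv' : ispath (rng f) p v by case: pv.
case: p pv' pv ge => [|f' p] pv' _ ge.
  by exists f; rewrite ge -edge_path -(pv' : rng f = v).
have [x [q [y [qy hf]]]] := sep_aut_path h (ispath1 f).
have [x' [q' [y' [qy' hp]]]] := sep_aut_path h pv'.
have eE : sepSe e = pathS q y * pathS q' y'.
  by rewrite -hf -hp -sgautM edge_path; exact/esym/sgaut_inv_eq.
have [|qqy qqE] := pathS_cat qy qy'; first by rewrite -eE; exact: edge_neq0.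
move: eE; rewrite qqE -edge_path.
move=> /(pathS_inj (ispath1 e) qqy)[_ + _].
case: q qy hf {qqy qqE} => [|f1 q] qy hf.
  by have := sep_aut_path_nil (ispath1 f) hf.
(* Here [:: e] is the concatenation of q and q', so one of them is empty. *)
case: q qy hf => [|f2 q] qy hf //.
case: q' qy' hp => [|f3 q'] qy' hp // _.
by have := sep_aut_path_nil pv' hp.
Qed.

Lemma sepS_morph_eq (h k : sepS E -> sepS E) :
  {morph h : a b / a * b} -> {morph k : a b / a * b} -> h sepS0 = k sepS0 ->
  (forall v, h (sepSv v) = k (sepSv v)) ->
  (forall e, h (sepSe e) = k (sepSe e)) -> h =1 k.
Proof.
move=> hM kM hk0 hkv hke; apply: morph_presented_eq => //.
case=> [v|[e|e]]; [exact: hkv|exact: hke|].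
by rewrite -[pgen _]/(sepSi e) sepSiE (morph_pinv _ hM) (morph_pinv _ kM) hke.
Qed.

Lemma sep_aut_ext g (k : sgaut (sepS E)) :
  (forall v, g (sepSv v) = k (sepSv v)) ->
  (forall e, g (sepSe e) = k (sepSe e)) -> g = k.
Proof.
move=> gkv gke; apply/sgaut_eq/sepS_morph_eq => //; first exact: sgautM.
  exact: sgautM.
by rewrite (sep_aut0 g) (sep_aut0 k).
Qed.

Definition induced phi (h : sepS E -> sepS E) : Prop :=
  [/\ forall v, h (sepSv v) = sepSv (autv phi v),
      forall e, h (sepSe e) = sepSe (aute phi e),
      forall e, h (sepSi e) = sepSi (aute phi e)
    & h sepS0 = sepS0].

Lemma aute_inj phi : injective (aute phi).
Proof. exact/bij_inj/aute_bij. Qed.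

Lemma autv_inj phi : injective (autv phi).
Proof. exact/bij_inj/autv_bij. Qed.

Lemma sepaut_induced_morph phi :
  exists2 h : sepS E -> sepS E, {morph h : a b / a * b} & induced phi h.
Proof.
pose F (x : generator E) : sepS E :=
  match x with
  | Vert v => sepSv (autv phi v)
  | DEdge (Edge e) => sepSe (aute phi e)
  | DEdge (EdgeInv e) => sepSi (aute phi e)
  end.
have FR s t : sep_rel s t -> ieval (@pinv _ _) sepS0 F s = ieval (@pinv _ _) sepS0 F t.
  case=> [v|v w vw|[e|e]|[e|e]|Z e _ _|Z e f CZ Ze Zf ef] /=.
  - exact: vertvv.
  - by apply: vertvw => /autv_inj.
  - by rewrite -aut_src src_edge.
  - by rewrite -aut_rng rng_edgeV.
  - by rewrite -aut_rng edge_rng.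
  - by rewrite -aut_src edgeV_src.
  - by rewrite -aut_rng edgeV_edge.
  - apply: same_block_edgeV_edge => [|/aute_inj //].
    by exists (aute phi @` Z); split; [exact: aut_sep|exists e|exists f].
have [h [hM h0 hg _]] := presented_universal (@pinvP _ _) (@pzeroP _ _) FR.
by exists h => //; split=> // x; exact: hg.
Qed.

Lemma sepaut_induced phi : exists g : sgaut (sepS E), induced phi g.
Proof.
have [h hM hphi] := sepaut_induced_morph phi.
have [k kM kphi] := sepaut_induced_morph (sepaut_inv phi).
have [hv he _ h0] := hphi; have [kv ke _ k0] := kphi.
have hk : cancel h k.
  apply: (@sepS_morph_eq (k \o h) id) => [a b|||v|e] //=.
  - by rewrite hM kM.
  - by rewrite /= h0 k0.
  - by rewrite hv kv /= autvK.
  - by rewrite he ke /= auteK.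
have kh : cancel k h.
  apply: (@sepS_morph_eq (h \o k) id) => [a b|||v|e] //=.
  - by rewrite kM hM.
  - by rewrite /= k0 h0.
  - by rewrite kv hv /= inv_autvK.
  - by rewrite ke he /= inv_auteK.
by exists (SgAut (Bijective hk kh) hM).
Qed.

(** An automorphism [g] and its inverse restrict to mutually inverse permutations
    of vertices and edges; these respect source, range and blocks because each
    of the three is defined by the multiplication. *)
Lemma induced_surj g : exists phi, induced phi g.
Proof.
have [fv gv] := choice (sep_aut_vert g).
have [fe ge] := choice (sep_aut_edge g).
have [kv hv] := choice (sep_aut_vert (sgaut_inv g)).
have [ke he] := choice (sep_aut_edge (sgaut_inv g)).
have gi e : g (sepSi e) = sepSi (fe e) by rewrite !sepSiE sep_aut_pinv ge.
have fvK : cancel fv kv.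
  by move=> v; apply: sepSv_inj; rewrite -hv -gv; exact: sgaut_funK.
have kvK : cancel kv fv.
  by move=> v; apply: sepSv_inj; rewrite -gv -hv; exact: sgaut_inv_funK.
have feK : cancel fe ke.
  by move=> e; apply: sepSe_inj; rewrite -he -ge; exact: sgaut_funK.
have keK : cancel ke fe.
  by move=> e; apply: sepSe_inj; rewrite -ge -he; exact: sgaut_inv_funK.
have fsrc e : src (fe e) = fv (src e).
  apply: (vert_mul_inj (edge_neq0 (e := fe e)) (src_edge _)).
  by rewrite -gv -ge -sgautM src_edge.
have frng e : rng (fe e) = fv (rng e).
  by apply: sepSv_inj; rewrite -gv -!edgeV_edge sgautM gi ge.
have fblock e f : same_block (fe e) (fe f) <-> same_block e f.
  rewrite !same_blockP !fsrc -gi -ge -sgautM.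
  split=> -[sef ef]; split.
  - exact: (can_inj fvK).
  - case: ef => [/(can_inj feK)|/sgaut_inv_eq]; first by left.
    by rewrite sep_aut0; right.
  - by rewrite sef.
  - by case: ef => [->|->]; [left|right; exact: sep_aut0].
have fsep Z : separation Z -> separation (fe @` Z).
  move=> CZ; have [e Ze] := separation_neq0 CZ.
  have [Y CY Ye] := separation_ex (fe e).
  (* Being in one block is preserved in both directions, so the image of the
     block of e is the whole block of its image. *)
  suff -> : fe @` Z = Y by [].
  apply/seteqP; split=> [_ [f Zf <-]|f Yf].
    have /fblock[Y' [CY' Ye' Yf']] : same_block e f by exists Z.
    by rewrite (separation_uniq CY CY' Ye Ye').
  exists (ke f); last exact: keK.
  have /fblock[Z' [CZ' Ze' Zf']] : same_block (fe e) (fe (ke f)).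
    by rewrite keK; exists Y.
  by rewrite (separation_uniq CZ CZ' Ze Ze').
exists (SepAut (Bijective fvK kvK) (Bijective feK keK) fsrc frng fsep).
by split; last exact: sep_aut0.
Qed.

End Automorphisms.

Theorem theorem4p11 (E : sepgraph) :
  exists Phi : sepaut E -> sgaut (sepS E),
    [/\ bijective Phi,
        {morph Phi : phi psi / (phi * psi)%g}
      & forall phi : sepaut E,
          [/\ forall v, Phi phi (sepSv v) = sepSv (autv phi v),
              forall e, Phi phi (sepSe e) = sepSe (aute phi e),
              forall e, Phi phi (sepSi e) = sepSi (aute phi e)
            & Phi phi sepS0 = sepS0]].
Proof.
have [Phi PhiP] := choice (@sepaut_induced E).
have [Psi PsiP] := choice (@induced_surj E).
exists Phi; split=> //.
- exists Psi => [phi|g].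
    have [Pv Pe _ _] := PhiP phi; have [Gv Ge _ _] := PsiP (Phi phi).
    apply: sepaut_eq => x.
      by apply: sepSv_inj; rewrite -Pv -Gv.
    by apply: sepSe_inj; rewrite -Pe -Ge.
  have [Pv Pe _ _] := PhiP (Psi g); have [Gv Ge _ _] := PsiP g.
  by apply: sep_aut_ext => x; rewrite ?Pv ?Pe ?Gv ?Ge.
- move=> phi psi; have [Pv Pe _ _] := PhiP phi; have [Qv Qe _ _] := PhiP psi.
  have [Mv Me _ _] := PhiP (phi * psi).
  by apply: sep_aut_ext => x /=; rewrite ?Mv ?Me ?Qv ?Qe ?Pv ?Pe.
Qed.
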